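(* Let $G$ be a graph, $\phi \in \mathrm{Aut}(G)$ an automorphism of $G$, $c$ a $2$-coloring of $E(G)$, and $k \geq 0$ an integer. If the length of the longest cycle in $\mathrm{Comp}(G,c)$ is less than $2k+3$, then there is a vertex $u \in V(G)$ such that there is a path in $G$ connecting $u$ and $\phi(u)$ that changes colors at most $k$ times.
   Context: A $2$-coloring of $E(G)$ is a function $c: E(G) \to \{\text{red}, \text{blue}\}$. A monochromatic component of $(G,c)$ is a connected component of the spanning subgraph of $G$ formed by the edges of one color (red or blue); each vertex lies in exactly one red and one blue monochromatic component. The component graph $\mathrm{Comp}(G,c)$ is the graph whose vertices are the monochromatic components of $G$ with coloring $c$, two of them being adjacent if the corresponding monochromatic components have at least one common vertex in $G$. A path changes colors $t$ times if there are exactly $t$ pairs of consecutive edges along the path that receive different colors.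
   Formalization: G is a finite simple graph, and some vertex v is assumed to be joined to φ(v) by a path in G (automatic if G is nonempty and connected); without this the claim fails, e.g. for two isolated vertices swapped by φ. An acyclic Comp(G,c) counts as having longest cycle length 0. *)

(* Defs.v *)
From mathcomp Require Import all_boot perm.

Set Implicit Arguments.
Unset Strict Implicit.
Unset Printing Implicit Defensive.

Record sgraph := SGraph {
  vertex :> finType;
  adj : rel vertex;
  adj_sym : symmetric adj;
  adj_irr : irreflexive adj }.

Definition automorphism (G : sgraph) (phi : {perm G}) : Prop :=
  forall x y : G, adj (phi x) (phi y) = adj x y.

Definition is_cycle (G : sgraph) (s : seq G) : bool :=
  [&& 2 < size s, uniq s & cycle (@adj G) s].

(* Length of a longest cycle; the value is 0 when G is acyclic.  Cycles have
   distinct vertices, so their lengths are at most #|G|. *)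
Definition circumference (G : sgraph) : nat :=
  \max_(n < #|G|.+1 | [exists s : n.-tuple G, is_cycle s]) n.

Definition edge_set (G : sgraph) : {set {set G}} :=
  [set A | [exists x, exists y, adj x y && (A == [set x; y])]].

Definition edge (G : sgraph) := {A : {set G} | A \in edge_set G}.

(* The two colors, red and blue. *)
Notation color := bool.

Section Coloring.
Variables (G : sgraph) (c : {ffun edge G -> color}).

(* None when x and y are not adjacent. *)
Definition edge_color (x y : G) : option color :=
  omap c (insub [set x; y] : option (edge G)).

Definition mono_adj (a : color) : rel G :=
  fun x y => edge_color x y == Some a.

Definition mono_component (a : color) (x : G) : {set G} :=
  [set y | connect (mono_adj a) x y].

(* A monochromatic component is tagged by its color: a red and a blue component
   with the same vertex set are different. *)
Definition mono_components : {set color * {set G}} :=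
  [set (a, mono_component a x) | a in [set: color], x in [set: G]].

Definition comp_vertex := {X : color * {set G} | X \in mono_components}.

Definition comp_adj : rel comp_vertex :=
  fun X Y => (X != Y) && ((val X).2 :&: (val Y).2 != set0).

Lemma comp_adj_sym : symmetric comp_adj.
Proof. by move=> X Y; rewrite /comp_adj eq_sym setIC. Qed.

Lemma comp_adj_irr : irreflexive comp_adj.
Proof. by move=> X; rewrite /comp_adj eqxx. Qed.

Definition Comp : sgraph := SGraph comp_adj_sym comp_adj_irr.

(* Number of color changes along the walk u :: p. *)
Definition color_changes (u : G) (p : seq G) : nat :=
  let s := pairmap edge_color u p in
  count (fun ab => ab.1 != ab.2) (zip s (behead s)).

End Coloring.

(* Main.v *)
Require Import Defs.
From mathcomp Require Import all_boot perm zify.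

Set Implicit Arguments.
Unset Strict Implicit.
Unset Printing Implicit Defensive.

(** A path of length [m] in [H = Comp c] from a component of [u] to a component
    of [v] yields a path from [u] to [v] changing colors at most [m] times.  If
    the theorem fails, then for every component [X] the set [N X] of components
    meeting [phi X] lies at distance more than [k] from [X]; it is connected,
    and [N X] meets [N Y] when [X] and [Y] are adjacent.

    Since [H] is bipartite, each edge of [N X] has an end [Z] at distance at
    least [k + 2] from [X].  Two disjoint [X]-[Z] paths would form a cycle of
    length at least [2k + 4], so by Menger some cut vertex separates [X] from
    [Z].  Choose [X] such that the component of [H - X] containing [N X] is
    smallest, and let [C] be the first cut vertex on a path from [X] to [Z].  By
    minimality [N C] lies on the side of [X] in [H - C], while [Z] does not.
    Along the path from [X] to [C] some [N D] therefore straddles [C]; then a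
    cut vertex separates [D] from [C], hence also [X] from [Z], and precedes
    [C] on the path. *)

(** * Two disjoint paths *)

Section Paths.
Variables (T : finType) (e : rel T).
Hypothesis e_sym : symmetric e.

Lemma connect_exit (r : rel T) (P : pred T) a b :
  connect r a b -> P a -> ~~ P b -> exists u v, [/\ r u v, P u & ~~ P v].
Proof.
case/connectP=> s; elim: s a => [|x s IHs] a /=; first by move=> _ -> ->.
case/andP=> rax rs lb Pa nPb; have [Px|nPx] := boolP (P x).
  exact: IHs rs lb Px nPb.
by exists a, x.
Qed.

Lemma path_last_exit (P : pred T) a s :
  P a -> exists s1 s2, [/\ s = s1 ++ s2, P (last a s1) & all (predC P) s2].
Proof.
move=> Pa; elim/last_ind: s => [|s x [s1 [s2 [-> Pl As2]]]].
  by exists [::], [::].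
have [Px|nPx] := boolP (P x).
  by exists (rcons (s1 ++ s2) x), [::]; rewrite cats0 last_rcons.
by exists s1, (rcons s2 x); rewrite -rcons_cat all_rcons /= nPx.
Qed.

Definition avoid y : rel T := fun s t => [&& s != y, t != y & e s t].

Lemma avoid_sym y : symmetric (avoid y).
Proof. by move=> s t; rewrite /avoid e_sym andbCA. Qed.

Lemma connect_avoidC y s t : connect (avoid y) s t = connect (avoid y) t s.
Proof. exact: (sym_connect_sym (avoid_sym y)). Qed.

Lemma path_avoid y x s :
  path e x s -> y \notin x :: s -> connect (avoid y) x (last x s).
Proof.
elim: s x => [|z s IHs] x //= /andP[exz zs].
rewrite !inE !negb_or => /and3P[yx yz ys].
apply: connect_trans (IHs z zs _); last by rewrite inE negb_or yz.
by apply: connect1; rewrite /avoid eq_sym yx eq_sym yz.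
Qed.

Lemma avoid_path y x s :
  x != y -> path (avoid y) x s -> path e x s /\ y \notin x :: s.
Proof.
elim: s x => [|z s IHs] x xy /=; first by rewrite inE eq_sym.
case/andP=> /and3P[_ zy exz] /(IHs z zy)[es ys].
by rewrite exz es inE negb_or eq_sym xy.
Qed.

Lemma avoid_connect y x z : connect (avoid y) x z -> connect e x z.
Proof. by apply: connect_sub => s t /and3P[_ _ /connect1]. Qed.

Lemma avoid_neq y x z : x != y -> connect (avoid y) x z -> z != y.
Proof.
move=> xy /connectP[s /(avoid_path xy)[_ ys] ->].
by apply: contraNneq ys => <-; rewrite mem_last.
Qed.

Lemma avoid_split y x a b :
  a != y -> connect (avoid y) a b -> ~~ connect (avoid x) a b ->
  connect (avoid y) a x.
Proof.
move=> ay /connectP[s ps ->] nc.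
have [es ys] := avoid_path ay ps.
have : x \in a :: s by apply: contraR nc; exact: path_avoid.
move=> xs; case/splitPl: xs ps {es ys nc} => s1 s2 <-.
by rewrite cat_path => /andP[ps1 _]; apply/connectP; exists s1.
Qed.

Definition separates y a b := [&& y != a, y != b & ~~ connect (avoid y) a b].

(* Adjacent vertices are linked: [p] and [q] may both be empty. *)
Definition linked a v := exists p q,
  [/\ path e a (rcons p v), path e a (rcons q v) & uniq [:: a, v & p ++ q]].

(** One new path follows [p] as far as [t] and then takes [R]; the other follows [q] to [v] and then
    the edge to [w]. The rest of [p] is dropped. *)
Lemma linked_detour a v w p q t R :
    path e a (rcons p v) -> path e a (rcons q v) -> uniq [:: a, v & p ++ q] ->
    e v w -> t \in a :: p -> path e t (rcons R w) -> uniq (w :: R) ->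
    {in w :: R, forall x, x \notin [:: a, v & p ++ q]} ->
  linked a w.
Proof.
move=> pp pq U evw tp; case/splitPl: tp pp U => p1 p2 <- pp U pR UR dis.
exists (p1 ++ R), (rcons q v); split.
- by move: pp; rewrite !rcons_cat !cat_path pR => /andP[->].
- by rewrite rcons_path pq last_rcons.
have UU : uniq ((w :: R) ++ [:: a, v & (p1 ++ p2) ++ q]).
  rewrite cat_uniq UR U andbT andTb; apply/hasPn=> x xin.
  by apply/negP=> /dis; rewrite xin.
have E : perm_eq ((w :: R) ++ [:: a, v & (p1 ++ p2) ++ q])
    ([:: a, w & (p1 ++ R) ++ rcons q v] ++ p2).
  clear; apply/seq.permP=> f.
  by rewrite -cats1 /= !count_cat /= ?count_cat /=; lia.
by move: UU; rewrite (perm_uniq E) cat_uniq => /andP[].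
Qed.

Lemma linked_step a v w :
  linked a v -> e v w -> w != a -> w != v -> connect (avoid v) a w ->
  linked a w.
Proof.
move=> [p [q [pp pq U]]] evw wa wv /connectP[s ps lw].
have [av [vp aq]] : a != v /\ v \notin p ++ q /\ a \notin p ++ q.
  by case/andP: U; rewrite inE negb_or => /andP[-> ->] /andP[->].
have [es vs] := avoid_path av ps.
case/shortenP: es lw vs => s' es' us' ss' lw vs.
have {}vs : v \notin a :: s'.
  by move: vs; rewrite !inE !negb_or => /andP[->]; apply: contra => /ss'.
have swap x y : uniq [:: a, v & x ++ y] -> uniq [:: a, v & y ++ x].
  rewrite (@perm_uniq _ _ [:: a, v & y ++ x]) //.
  by rewrite !perm_cons perm_catC.
(* If [w] already lies on one of the paths, cut that path at [w] and prolong the other by the edge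
   from [v]. *)
wlog wnp : p q pp pq U vp aq / w \notin p ++ q => [H|].
  have [wpq|wpq] := boolP (w \in p ++ q); last exact: (H p q).
  have redirect p' q' : path e a (rcons p' v) -> path e a (rcons q' v) ->
      uniq [:: a, v & p' ++ q'] -> w \in p' -> linked a w.
    move=> pp' pq' U' wp; case/splitPr: wp pp' U' => p1 p2 pp' U'.
    exists p1, (rcons q' v); split.
    - by move: pp'; rewrite rcons_cat -cat_rcons cat_path => /andP[].
    - by rewrite rcons_path pq' last_rcons.
    have E : perm_eq [:: a, v & (p1 ++ w :: p2) ++ q']
      ([:: a, w & p1 ++ rcons q' v] ++ p2).
      clear; apply/seq.permP=> f.
      by rewrite -cats1 /= !count_cat /= ?count_cat /=; lia.
    by move: U'; rewrite (perm_uniq E) cat_uniq => /andP[].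
  move: wpq; rewrite mem_cat => /orP[wp|wq]; first exact: redirect pp pq U wp.
  exact: redirect pq pp (swap _ _ U) wq.
(* Leave the two linked paths for the last time, at [t]: the rest of the simple path to [w] is then
   disjoint from both. *)
have [s1 [s2 [Es Pl As2]]] :=
  path_last_exit (P := mem [:: a, v & p ++ q]) s' (mem_head a _).
have ls : last a s1 \in a :: s' by rewrite Es -cat_cons mem_cat mem_last.
set t := last a s1 in Pl ls.
have tv : t != v by apply: contraNneq vs => <-.
have wnot : w \notin [:: a, v & p ++ q] by rewrite !inE (negPf wa) (negPf wv).
case: (lastP s2) => [|R w'] in Es As2.
  by move: wnot; rewrite lw Es cats0 => /negP[].
have Ew : w' = w by rewrite lw Es last_cat last_rcons.
subst w'.
have pR : path e t (rcons R w) by move: es'; rewrite Es cat_path => /andP[].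
have UR : uniq (w :: R).
  by move: us'; rewrite Es /= cat_uniq rcons_uniq => /and4P[_ _ _].
have dis : {in w :: R, forall x, x \notin [:: a, v & p ++ q]}.
  by move=> x; rewrite -mem_rcons => /(allP As2).
have : (t \in a :: p) || (t \in a :: q).
  by move: Pl; rewrite /= !inE mem_cat (negPf tv) /= orbA; case: (t == a).
case/orP=> tin; first exact: linked_detour pp pq U evw tin pR UR dis.
apply: linked_detour pq pp (swap _ _ U) evw tin pR UR _ => x /dis.
by rewrite !inE !mem_cat (orbC (x \in p)).
Qed.

(* Menger's theorem for two paths, by Whitney's induction along a path from [a]
   to [b], each vertex of which turns out to be linked to [a]. *)
Lemma linked_or_separates a b :
  irreflexive e -> a != b -> connect e a b ->
  (exists y, separates y a b) \/ linked a b.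
Proof.
move=> e_irr ab /connectP[s ps lb].
have [y sy|nosep] := pickP (fun y => separates y a b); first by left; exists y.
right; case/shortenP: ps lb => s' ps' us' _ {s} lb.
have : s' != [::] by apply: contra_neq ab => s0; rewrite lb s0.
suff main s1 v s2 : s' = s1 ++ v :: s2 -> linked a v.
  case/lastP: s' ps' us' lb main => // s v _ _ -> main _.
  by rewrite last_rcons; apply: (main s v [::]); rewrite cats1.
elim/last_ind: s1 v s2 => [|s1 v' IHs] v s2 Es.
  exists [::], [::]; move: ps' us'; rewrite Es /= => /andP[-> _].
  by rewrite inE negb_or => /andP[/andP[av _] _]; split; rewrite //= inE av.
have {}IHs := IHs v' (v :: s2); rewrite -cat_rcons in IHs.
move: (IHs Es) => lk.
have av' : a != v'.
  move: us'; rewrite Es /= mem_cat mem_rcons inE !negb_or.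
  by case/andP=> /andP[/andP[]].
have av : a != v.
  by move: us'; rewrite Es /= mem_cat !inE !negb_or => /andP[/andP[_ /andP[]]].
have v'n : v' \notin v :: s2.
  move: us'; rewrite Es cons_uniq cat_uniq => /and4P[_ _ /hasPn dis _].
  by apply/negP=> /dis; rewrite mem_rcons mem_head.
have [evv ps2] : e v' v /\ path e v s2.
  by move: ps'; rewrite Es cat_path last_rcons /= => /and3P[].
have {}lb : b = last v s2 by rewrite lb Es last_cat.
apply: linked_step lk evv _ _ _; first by rewrite eq_sym.
  by apply: contraNneq v'n => <-; rewrite mem_head.
(* Since [v'] does not separate [a] from [b], go from [a] to [b] around [v'], then back to [v] along
   the tail [s2]. *)
have vb := path_avoid ps2 v'n.
apply: (@connect_trans _ _ b); last by rewrite connect_avoidC lb.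
have := nosep v'; rewrite /separates eq_sym av' /=.
have -> : v' != b by apply: contraNneq v'n => ->; rewrite lb mem_last.
by move/negbFE.
Qed.

Lemma linked_cycle a b d :
  linked a b -> (forall s, path e a s -> last a s = b -> d <= size s) ->
  exists s, [/\ uniq s, cycle e s & 2 * d <= size s].
Proof.
move=> [p [q [pp pq U]]] far; exists (a :: p ++ b :: rev q); split.
- rewrite (@perm_uniq _ _ [:: a, b & p ++ q]) //; apply/seq.permP=> f.
  by rewrite /= !count_cat /= count_rev; lia.
- rewrite /= rcons_cat /= -cat_rcons cat_path pp last_rcons -rev_cons.
  have := rev_path e a (rcons q b); rewrite last_rcons belast_rcons => ->.
  by rewrite -(eq_path (e := e)) // => x y; exact: e_sym.
have := far _ pp (last_rcons _ _ _); have := far _ pq (last_rcons _ _ _).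
by rewrite /= size_cat /= size_rev !size_rcons; lia.
Qed.
End Paths.

(** * Evasive set-valued maps *)

Section Evasion.
(** Abstract form of the component graph: [T] holds the components, [col] their colors, [N x] the
    components meeting the image of [x]. [N_far] expresses the failure of the theorem. *)
Variables (T : finType) (e : rel T) (col : T -> bool) (N : T -> {set T}).
Variables (k : nat) (x0 z0 : T).
Hypotheses (e_sym : symmetric e) (e_col : forall x y, e x y -> col x != col y).
Hypothesis N_connected : forall x y z, y \in N x -> z \in N x ->
  connect [rel s t | [&& s \in N x, t \in N x & e s t]] y z.
Hypothesis N_far : forall x s, path e x s -> last x s \in N x -> k < size s.
Hypothesis N_edge : forall x z, z \in N x -> exists2 z', z' \in N x & e z z'.
Hypothesis N_meet : forall x y, e x y -> exists2 z, z \in N x & z \in N y.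
Hypotheses (N0 : z0 \in N x0) (x0z0 : connect e x0 z0).

Let far x z := forall s, path e x s -> last x s = z -> k.+1 < size s.

Let e_irr : irreflexive e.
Proof. by move=> x; apply/negP=> /e_col; rewrite eqxx. Qed.

Let conn_sym : connect_sym e.
Proof. exact: sym_connect_sym. Qed.

Lemma odd_path x s : path e x s -> odd (size s) = (col x != col (last x s)).
Proof.
elim: s x => [|y s IHs] x /=; first by rewrite eqxx.
by case/andP=> /e_col exy /IHs ->; move: exy; do 3!case: (col _).
Qed.

Lemma N_neq x z : z \in N x -> z != x.
Proof. by apply: contraTneq => ->; apply/negP=> /(@N_far x [::] isT). Qed.

(** Along a path from [x0], consecutive sets [N] overlap and each is connected, so neither
    nonemptiness nor reachability is lost. *)
Lemma N_reachable x : connect e x0 x ->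
  (exists z, z \in N x) /\ {in N x, forall z, connect e x z}.
Proof.
have sub y z t : z \in N y -> t \in N y -> connect e z t.
  move=> zN /(N_connected zN); apply: connect_sub => a b /and3P[_ _ ab].
  exact: connect1.
case/connectP=> s; elim/last_ind: s x => [|s y IHs] x /=.
  move=> _ ->; split; first by exists z0.
  by move=> z /(sub _ _ _ N0); apply: connect_trans.
rewrite rcons_path last_rcons => /andP[/IHs/(_ erefl)[_ IH] ey ->].
have [z zl zy] := N_meet ey; split; first by exists z.
move=> t /(sub _ _ _ zy); apply: connect_trans.
by apply: connect_trans (IH z zl); rewrite conn_sym connect1.
Qed.

(* Distances to the two ends of an edge have opposite parities. *)
Lemma far_edge x z z' :
  z \in N x -> z' \in N x -> e z z' -> far x z \/ far x z'.
Proof.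
move=> zN z'N /e_col; have [oz cz|oz cz] := eqVneq (odd k.+1) (col x != col z).
  right=> s ps ls; have := odd_path ps.
  have : k < size s by apply: (N_far ps); rewrite ls.
  rewrite leq_eqVlt => /predU1P[<-|//]; rewrite oz ls.
  by move: cz; do 3!case: (col _).
left=> s ps ls; have := odd_path ps.
have : k < size s by apply: (N_far ps); rewrite ls.
by rewrite leq_eqVlt => /predU1P[<-|//]; rewrite ls => /eqP; rewrite (negPf oz).
Qed.

Hypothesis no_long_cycle : forall s, uniq s -> cycle e s -> size s < 2 * k.+2.

Lemma far_separates x z : connect e x0 x -> z \in N x -> far x z ->
  exists y, separates e y x z.
Proof.
move=> x0x zN fz; have [_ /(_ z zN) xz] := N_reachable x0x.
have xnz : x != z by rewrite eq_sym N_neq.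
have [//|lk] := linked_or_separates e_sym e_irr xnz xz.
have [s [us cs ss]] := linked_cycle e_sym lk fz.
by have := no_long_cycle us cs; rewrite ltnNge ss.
Qed.

(* If [N d] straddled a cut vertex [x] it would contain [x] and a neighbour of
   [x] on the side of [d]; the farther of the two is separated from [d]. *)
Lemma straddle_separates x d t t' :
    connect e x0 d -> d != x -> t \in N d -> t' \in N d ->
    connect (avoid e x) d t -> ~~ connect (avoid e x) d t' ->
  exists y, separates e y d x.
Proof.
move=> x0d dx tN t'N ct nct'.
have [w [v [/and3P[/= wN vN ewv] cw ncv]]] :=
  connect_exit (N_connected tN t'N) ct nct'.
have wx := avoid_neq dx cw.
have vx : v = x.
  apply/eqP; apply: contraNT ncv => vx; apply: connect_trans cw (connect1 _).
  by rewrite /avoid wx vx.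
subst v; have [fw|fx] := far_edge wN vN ewv; last exact: far_separates vN fx.
(* The cut vertex [y] for [w] is not [x], because [d] reaches [w] around [x]; so it also cuts off
   [x], a neighbor of [w]. *)
have [y /and3P[yd yw ncy]] := far_separates x0d wN fw.
have yx : y != x by apply: contraNneq ncy => ->.
exists y; rewrite /separates yd yx; apply: contra ncy => cyx.
apply: connect_trans cyx (connect1 _).
by rewrite /avoid eq_sym yx eq_sym yw e_sym.
Qed.

Let K x z := [set t | connect (avoid e x) z t].

Lemma evasion_impossible : False.
Proof.
(* The X and C of the overview are called [c] and [x] below. *)
pose pairs := [pred p : T * T | connect e x0 p.1 && (p.2 \in N p.1)].
have P0 : pairs (x0, z0) by rewrite /= connect0.
case: (arg_minnP (fun p => #|K p.1 p.2|) P0) => -[c z1] /= /andP[x0c z1N] minK.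
(* An edge inside [N c] does not touch [c], so its far end can replace [z1] without changing the
   component. *)
have [z [zN fz Kz]] : exists z, [/\ z \in N c, far c z & #|K c z1| = #|K c z|].
  have [z2 z2N e12] := N_edge z1N.
  have [f1|f2] := far_edge z1N z2N e12; [by exists z1|exists z2; split=> //].
  congr #|pred_of_set _|; apply/setP=> t; rewrite !inE.
  apply: same_connect; first exact: sym_connect_sym (avoid_sym e_sym c).
  by apply: connect1; rewrite /avoid !N_neq.
have {Kz}minK d t : connect e x0 d -> t \in N d -> #|K c z| <= #|K d t|.
  by move=> x0d tN; rewrite -Kz (minK (d, t)) //= x0d.
have [y0 sep0] := far_separates x0c zN fz.
have cz : c != z by rewrite eq_sym N_neq.
have [_ /(_ z zN) ecz] := N_reachable x0c.
case/connectP: ecz => p pp; case/shortenP: pp => {}p pp up _ lz.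
have sepp y : separates e y c z -> y \in p.
  case/and3P=> yc yz; apply: contraR => yp; rewrite lz.
  by apply: path_avoid => //; rewrite inE negb_or yc.
have hasp : has (fun y => separates e y c z) p.
  by apply/hasP; exists y0 => //; exact: sepp.
(* [x] is the first separator on [p]: no vertex of [p1] separates [c] from [z]. *)
case/split_find: hasp pp up lz => x p1 p2 sepx nop1.
rewrite -cats1 -catA cat1s cat_path => /andP[pp1 /= /andP[e1 pp2]].
move=> up lz.
have [xc xz ncz] := and3P sepx.
have pq : path e c (rcons p1 x) by rewrite rcons_path pp1.
have uq : uniq (c :: rcons p1 x).
  have := up; rewrite -cat_rcons /= cat_uniq mem_cat negb_or.
  by case/andP=> /andP[-> _] /andP[->].
have up2 : c \notin x :: p2.
  by move: up; rewrite /= mem_cat negb_or => /andP[/andP[]].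
have {}lz : z = last x p2 by rewrite lz last_cat.
have xp1 : x \notin p1 by move: uq; rewrite /= rcons_uniq => /and3P[].
have zp1 : z \notin p1.
  move: up; rewrite cat_uniq => /and4P[_ _ /hasPn dis _].
  by apply/negP=> zp; have := dis z; rewrite lz mem_last -lz /= zp => /(_ isT).
have x0x : connect e x0 x.
  apply: connect_trans x0c _; apply/connectP; exists (rcons p1 x) => //.
  by rewrite last_rcons.
have cxz : connect (avoid e c) x z by rewrite lz; exact: path_avoid.
(* Otherwise [K x t] would be contained in [K c z] and miss its element [x], against minimality. *)
have xgood t : t \in N x -> connect (avoid e x) c t.
  move=> tN; apply: contraT => nct.
  have [_ /(_ t tN) /connectP[r pr lr]] := N_reachable x0x.
  (* A simple path from [x] to [t] through [c] would lead from [c] to [t] without returning to [x],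
     against [nct]. *)
  have cxt : connect (avoid e c) x t.
    case/shortenP: pr lr => {}r pr ur _ lr.
    have [cr|cr] := boolP (c \in x :: r); last by rewrite lr path_avoid.
    case/negP: nct; rewrite lr; move: cr.
    rewrite inE eq_sym (negPf xc) /= => cr.
    case/splitPr: cr pr ur => r1 r2; rewrite cat_path /= => /and3P[_ _ pr2].
    rewrite cat_uniq => /and4P[xr _ _ _]; rewrite last_cat /=.
    apply: path_avoid => //; apply: contra xr => xr.
    by rewrite mem_cat xr orbT.
  suff : K x t \proper K c z by move/proper_card; rewrite ltnNge minK.
  have tx := N_neq tN.
  apply/properP; split.
    apply/subsetP=> s; rewrite !inE => cts.
    rewrite (connect_avoidC e_sym) in cxz.
    apply: connect_trans (connect_trans cxz cxt) _.
    case/connectP: cts => r' pr' ->; have [er' xr'] := avoid_path tx pr'.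
    apply: path_avoid => //; apply: contra nct => cr'.
    rewrite (connect_avoidC e_sym); case/splitPl: cr' pr' => r1 r2 <-.
    by rewrite cat_path => /andP[pr1 _]; apply/connectP; exists r1.
  exists x; rewrite inE; first by rewrite (connect_avoidC e_sym).
  by apply/negP=> /(avoid_neq tx); rewrite eqxx.
pose good d := [forall t in N d, connect (avoid e x) c t].
have badc : ~~ good c.
  by apply/negP=> /forall_inP/(_ z zN); rewrite (negPf ncz).
have goodx : good x by apply/forall_inP.
(* On the path from the bad vertex [c] to the good vertex [x], some bad [d] is directly followed by
   a good [d']. *)
have [L [d [d' [M [Es bad_d good_d']]]]] :
    exists L d d' M,
    [/\ c :: rcons p1 x = L ++ [:: d, d' & M], ~~ good d & good d'].
  elim: (p1) (c) badc => [|y p' IH] c' badc'; first by exists [::], c', x, [::].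
  have [gy|/IH[L [d [d' [M [Es bd gd]]]]]] := boolP (good y).
    by exists [::], c', y, (rcons p' x).
  by exists (c' :: L), d, d', M; rewrite /= Es.
have lx : last d' M = x.
  by have := congr1 (last c) Es; rewrite /= last_rcons last_cat.
have dcp1 : d \in c :: p1.
  move/esym: Es; rewrite -rcons_cons; case: (lastP M) => [|M' m].
    by rewrite -cat_rcons cats1 => /rcons_inj[<- _]; rewrite mem_rcons mem_head.
  rewrite -[[:: d, d' & rcons M' m]]/(rcons [:: d, d' & M'] m) -rcons_cat.
  by case/rcons_inj=> <- _; rewrite mem_cat mem_head orbT.
have dx : d != x.
  by apply: contraTneq dcp1 => ->; rewrite inE negb_or xc.
have cd : connect (avoid e x) c d.
  case/splitPl: dcp1 xp1 pp1 => q1 q2 <-; rewrite mem_cat negb_or cat_path.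
  move=> /andP[xq1 _] /andP[pq1 _]; apply: path_avoid => //.
  by rewrite inE negb_or xc.
have [x0d ed] : connect e x0 d /\ path e d (d' :: M).
  split; first by apply: connect_trans x0c (avoid_connect cd).
  case: L Es => [[<- Es]|c' L [_ Es]]; move: pq; rewrite Es //.
  by rewrite cat_path => /andP[_ /andP[]].
(* [N d] straddles [x]: [t'] lies off the side of [c], while [t], shared with [N d'], lies on it. *)
have [t' t'N nct'] : exists2 t', t' \in N d & ~~ connect (avoid e x) c t'.
  by case/forall_inPn: bad_d => t' ? ?; exists t'.
have [t tN tN'] : exists2 t, t \in N d & t \in N d'.
  by apply: N_meet; case/andP: ed.
have ct : connect (avoid e x) c t by move/forall_inP: good_d'; apply.
have dc := cd; rewrite (connect_avoidC e_sym) in dc.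
have [||y /and3P[yd yx ncy]] := straddle_separates x0d dx tN t'N.
- exact: connect_trans dc ct.
- by apply: contra nct'; exact: connect_trans cd.
(* The stretch from [d] to [x] must contain [y]. As the whole path is simple, [y] is not met
   earlier, so it lies in [p1] and does not separate [c] from [z]. *)
have yM : y \in d' :: M.
  apply: contraR ncy => yM; rewrite -lx -[last d' M]/(last d (d' :: M)).
  by apply: path_avoid; rewrite // inE negb_or yd.
have [yc yL] : y != c /\ y \notin L.
  have : y \notin rcons L d.
    move: uq; rewrite Es -cat_rcons cat_uniq => /and3P[_ /hasPn dis _].
    exact: dis.
  rewrite mem_rcons inE negb_or => /andP[_ yL]; split=> //.
  apply: contraNneq yL => yc; subst y.
  case: L Es => [|c' L] [E _]; last by rewrite E mem_head.
  by rewrite E eqxx in yd.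
have yp1 : y \in p1.
  have : y \in c :: rcons p1 x by rewrite Es mem_cat !inE -in_cons yM !orbT.
  by rewrite inE mem_rcons inE (negPf yc) (negPf yx).
have cyz : connect (avoid e y) c z.
  have yz : y != z by apply: contraNneq zp1 => <-.
  by have := hasPn nop1 y yp1; rewrite /separates yc yz negbK.
have cyd : connect (avoid e y) d c.
  rewrite (connect_avoidC e_sym); case: L Es yL => [|c' L] [<- Es].
    by rewrite connect0.
  rewrite inE negb_or => /andP[_ yL].
  have := pq; rewrite Es -cat_rcons cat_path => /andP[pL _].
  rewrite -[d](last_rcons c L); apply: path_avoid => //.
  by rewrite inE mem_rcons inE !negb_or yc yd.
(* The walk from [d] back to [c] and on to [z] avoids [y]. It must pass [x], which cuts [d] from
   [z], so [d] reaches [x] around [y]. *)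
case/negP: ncy; apply: avoid_split (connect_trans cyd cyz) _.
  by rewrite eq_sym.
by apply: contra ncz; exact: connect_trans cd.
Qed.
End Evasion.

(** * Color changes and the component graph *)

Section Changes.
Variable C : eqType.

Definition changes (s : seq C) :=
  count (fun ab => ab.1 != ab.2) (zip s (behead s)).

Lemma changes_cons2 a b s : changes [:: a, b & s] = (a != b) + changes (b :: s).
Proof. by []. Qed.

Lemma changes_cons a s : changes s <= changes (a :: s).
Proof. by case: s => // b s; rewrite changes_cons2 leq_addl. Qed.

Lemma changes_recolor a b s : changes (a :: s) <= (a != b) + changes (b :: s).
Proof.
case: s => // x s; rewrite !changes_cons2 addnA leq_add2r.
by case: (eqVneq a b) => [->|_] //; case: (a == x); case: (b == x).
Qed.

Lemma changes_nseq a n s : changes (a :: nseq n a ++ s) = changes (a :: s).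
Proof. by elim: n => // n IHn; rewrite changes_cons2 eqxx. Qed.

(** When the head [y] of [s2] is deleted, [changes_recolor] turns the leading [a] into [y] at the
    cost of the change from [a] to [y], which [a :: s2] pays as well. *)
Lemma changes_subseq_cons a s1 s2 :
  subseq s1 s2 -> changes (a :: s1) <= changes (a :: s2).
Proof.
elim: s2 a s1 => [|y s2 IHs] a [|z s1] //= sub.
rewrite [leqRHS]changes_cons2; move: sub; have [-> /IHs|_ /IHs] := eqVneq z y.
  by rewrite changes_cons2 leq_add2l.
move/(_ y) => H; apply: leq_trans (changes_recolor a y _) _.
by rewrite leq_add2l.
Qed.

Lemma changes_subseq s1 s2 : subseq s1 s2 -> changes s1 <= changes s2.
Proof.
elim: s2 s1 => [|y s2 IHs] [|z s1] //=; have [-> |_ /IHs H] := eqVneq z y.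
  exact: changes_subseq_cons.
exact: leq_trans H (changes_cons y s2).
Qed.
End Changes.

(** * Monochromatic components and walks through them *)

Section Components.
Variables (G : sgraph) (c : {ffun edge G -> color}).
Implicit Types (x y u v : G) (a b : color).

Let H := Comp c.
Let ec := edge_color c.

Lemma edge_colorC x y : ec x y = ec y x.
Proof. by rewrite /ec /edge_color setUC. Qed.

Lemma mono_adj_sym a : symmetric (mono_adj c a).
Proof. by move=> x y; rewrite /mono_adj -/ec edge_colorC. Qed.

Lemma mono_adj_adj a x y : mono_adj c a x y -> adj x y.
Proof.
rewrite /mono_adj /edge_color; case: insubP => //= A.
rewrite inE => /existsP[x' /existsP[y' /andP[axy /eqP E]]] _ _.
have xy' : x' != y' by apply: contraTneq axy => ->; rewrite adj_irr.
have xy : x != y.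
  apply: contra_neq xy' => xy; subst y; move: E; rewrite setUid => E.
  have := set21 x' y'; have := set22 x' y'; rewrite -E !inE.
  by move=> /eqP-> /eqP->.
have := set21 x y; have := set22 x y; rewrite E !inE.
case/orP=> /eqP Ey /orP[/eqP Ex|/eqP Ex]; subst x y => //.
- by rewrite eqxx in xy.
- by rewrite adj_sym.
- by rewrite eqxx in xy.
Qed.

Lemma adj_mono_adj x y : adj x y -> exists a, mono_adj c a x y.
Proof.
move=> axy; rewrite /mono_adj /edge_color; case: insubP => [A _ _|/negP[]] /=.
  by exists (c A).
rewrite inE; apply/existsP; exists x; apply/existsP; exists y.
by rewrite axy eqxx.
Qed.

Lemma mono_componentP a x : (a, mono_component c a x) \in mono_components c.
Proof. by apply/imset2P; exists a x; rewrite ?inE. Qed.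

Definition component_of a x : H :=
  exist (fun X => X \in mono_components c) _ (mono_componentP a x).

Definition members (X : H) : {set G} := (val X).2.
Definition hue (X : H) : color := (val X).1.

Lemma mem_component_of a x : x \in members (component_of a x).
Proof. by rewrite inE connect0. Qed.

Lemma component_ofE X x : x \in members X -> X = component_of (hue X) x.
Proof.
case: X => -[a A] /= Ain; rewrite /members /hue /= => xA; apply: val_inj => /=.
case/imset2P: (Ain) => b y _ _ [Ea EA]; subst a; congr (_, _).
move: xA; rewrite EA inE => xy; apply/setP=> z; rewrite !inE.
by apply: same_connect => //; apply: sym_connect_sym; exact: mono_adj_sym.
Qed.

Lemma members_connect X x y :
  x \in members X -> y \in members X -> connect (mono_adj c (hue X)) x y.
Proof. by move/component_ofE=> E; rewrite {1}E inE. Qed.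

Lemma members_closed X x y :
  x \in members X -> mono_adj c (hue X) x y -> y \in members X.
Proof. by move/component_ofE=> E xy; rewrite E inE connect1. Qed.

Lemma comp_adjP X Y x : x \in members X -> x \in members Y -> X != Y ->
  adj X Y.
Proof.
move=> xX xY XY; apply/andP; split=> //; apply/set0Pn.
by exists x; rewrite inE xX.
Qed.

Lemma comp_adj_ex X Y : adj X Y -> exists2 x, x \in members X & x \in members Y.
Proof. by case/andP=> _ /set0Pn[x /setIP[xX xY]]; exists x. Qed.

Lemma comp_adj_hue X Y : adj X Y -> hue X != hue Y.
Proof.
move=> XY; have [x xX xY] := comp_adj_ex XY.
apply: contraTneq XY => E; rewrite (component_ofE xX) (component_ofE xY) E.
by rewrite adj_irr.
Qed.

Lemma mono_path_changes a u v : connect (mono_adj c a) u v ->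
  exists p, [/\ path (@adj G) u p, last u p = v &
    pairmap ec u p = nseq (size p) (Some a)].
Proof.
case/connectP=> p; elim: p u => [|x p IHp] u /=.
  by move=> _ ->; exists [::].
case/andP=> ux /IHp IH /IH[q [pq lq Eq]]; exists (x :: q); split=> //=.
  by rewrite (mono_adj_adj ux).
by rewrite Eq; move/eqP: ux => ux; rewrite /ec ux.
Qed.

(** The walk keeps one color inside each component and may switch at a vertex common to two
    consecutive ones. The color of [X] in front lets the induction charge each switch even when the
    walk inside a component is empty. *)
Lemma comp_path_changes X q u v :
    path (@adj H) X q -> u \in members X -> v \in members (last X q) ->
  exists p, [/\ path (@adj G) u p, last u p = v &
    changes (Some (hue X) :: pairmap ec u p) <= size q].
Proof.
elim: q X u => [|Y q IHq] X u /=.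
  move=> _ uX vX.
  have [p [pp lp Ep]] := mono_path_changes (members_connect uX vX).
  by exists p; split=> //; rewrite Ep -[nseq _ _]cats0 changes_nseq.
case/andP=> XY pq uX vY; have [w wX wY] := comp_adj_ex XY.
have [p1 [pp1 lp1 Ep1]] := mono_path_changes (members_connect uX wX).
have [p2 [pp2 lp2 Ep2]] := IHq Y w pq wY vY.
exists (p1 ++ p2); split.
- by rewrite cat_path pp1 lp1.
- by rewrite last_cat lp1.
rewrite pairmap_cat Ep1 changes_nseq lp1.
apply: leq_trans (changes_recolor _ (Some (hue Y)) _) _.
by rewrite -add1n leq_add // leq_b1.
Qed.

(** When [u] recurs, restart from the recurrence; this keeps a suffix of the colors. *)
Lemma path_shortcut u p : path (@adj G) u p ->
  exists q, [/\ path (@adj G) u q, uniq (u :: q), last u q = last u p &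
    subseq (pairmap ec u q) (pairmap ec u p)].
Proof.
elim: p u => [|v p IHp] u /=; first by exists [::].
case/andP=> uv /IHp[q [pq uq lq sq]].
have [uin|unin] := boolP (u \in v :: q); last first.
  exists (v :: q); split=> //=; [by rewrite uv|by rewrite unin|].
  by rewrite eqxx.
case/splitPl: uin pq uq lq sq => q1 q2 lq1.
rewrite cat_path lq1 -cat_cons cat_uniq last_cat lq1 pairmap_cat lq1.
case/andP=> _ pq2 /and3P[_ /hasPn dis uq2] lq2 sq; exists q2; split=> //.
  by rewrite /= uq2 andbT; apply/negP=> /dis; rewrite -lq1 /= mem_last.
exact: subseq_trans (subseq_trans (suffix_subseq _ _) sq) (subseq_cons _ _).
Qed.

(** * Components met by the image of a component *)

Variable phi : {perm G}.
Hypothesis hphi : automorphism phi.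

Definition images (X : H) : {set H} :=
  [set Y | [exists u in members X, phi u \in members Y]].

Lemma imagesP X Y :
  reflect (exists2 u, u \in members X & phi u \in members Y) (Y \in images X).
Proof. by rewrite inE; exact: exists_inP. Qed.

(** [phi] sends an edge [uw] inside [X] to an edge of some color, whose component contains [phi u]
    and [phi w]. Components sharing a vertex are equal or adjacent, so a path inside [X] yields a
    chain of components. *)
Lemma images_connected X Y Z : Y \in images X -> Z \in images X ->
  connect [rel S T | [&& S \in images X, T \in images X & adj S T]] Y Z.
Proof.
set r := [rel _ _ | _].
have share u S T :
    u \in members X -> phi u \in members S -> phi u \in members T ->
    connect r S T.
  move=> uX uS uT; have [->|ST] := eqVneq S T; first exact: connect0.
  apply: connect1; apply/and3P; split; last exact: comp_adjP uS uT ST.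
    by apply/imagesP; exists u.
  by apply/imagesP; exists u.
case/imagesP=> u uX uY /imagesP[v vX vZ].
case/connectP: (members_connect uX vX) => p.
elim: p u Y uX uY => [|w p IHp] u Y uX uY /=.
  by move=> _ E; subst v; exact: share uX uY vZ.
case/andP=> uw pp lv; have wX := members_closed uX uw.
have phi_uw : adj (phi u) (phi w) by rewrite hphi (mono_adj_adj uw).
have [b uwb] := adj_mono_adj phi_uw; have uB := mem_component_of b (phi u).
have wB : phi w \in members (component_of b (phi u)).
  exact: members_closed uB uwb.
exact: connect_trans (share _ _ _ uX uY uB) (IHp _ _ wX wB pp lv).
Qed.

Lemma images_edge X Y : Y \in images X -> exists2 Z, Z \in images X & adj Y Z.
Proof.
case/imagesP=> u uX uY; have uZ := mem_component_of (~~ hue Y) (phi u).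
exists (component_of (~~ hue Y) (phi u)); first by apply/imagesP; exists u.
by apply: comp_adjP uY uZ _; apply/eqP=> /(congr1 hue) /=; case: (hue Y).
Qed.

Lemma images_meet X Y : adj X Y -> exists2 Z, Z \in images X & Z \in images Y.
Proof.
case/comp_adj_ex=> u uX uY; exists (component_of true (phi u));
  by apply/imagesP; exists u => //; exact: mem_component_of.
Qed.

Lemma component_of_connect u v : connect (@adj G) u v ->
  connect (@adj H) (component_of true u) (component_of true v).
Proof.
have share x S T : x \in members S -> x \in members T -> connect (@adj H) S T.
  move=> xS xT; have [->|ST] := eqVneq S T; first exact: connect0.
  exact: connect1 (comp_adjP xS xT ST).
case/connectP=> p; elim: p u => [|w p IHp] u /=; first by move=> _ ->.
case/andP=> /adj_mono_adj[a uw] /IHp IH /IH; apply: connect_trans.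
have uA := mem_component_of a u.
apply: connect_trans (share u _ _ (mem_component_of _ _) uA) _.
exact: share (members_closed uA uw) (mem_component_of _ _).
Qed.
End Components.

(** * The circumference bound and the conclusion *)

Lemma size_cycle_circumference (G : sgraph) (s : seq G) :
  2 < size s -> uniq s -> cycle (@adj G) s -> size s <= circumference G.
Proof.
move=> s2 us cs.
have ss : size s < #|G|.+1 by rewrite ltnS -(card_uniqP us) max_card.
rewrite /circumference -[size s]/(val (Ordinal ss)).
apply: (@leq_bigmax_cond _ _ (fun n : 'I__ => n : nat)).
by apply/existsP; exists (in_tuple s); rewrite /is_cycle s2 us.
Qed.

Theorem theorem2 (G : sgraph) (phi : {perm G}) (hphi : automorphism phi)
    (c : {ffun edge G -> color}) (k : nat)
    (hconn : exists v : G, connect (@adj G) v (phi v))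
    (hcyc : circumference (Comp c) < 2 * k + 3) :
  exists (u : G) (p : seq G),
    [/\ path (@adj G) u p, uniq (u :: p), last u p = phi u
      & color_changes c u p <= k].
Proof.
have [v0 v0phi] := hconn.
pose near X := [exists n : 'I_k.+1, exists q : n.-tuple (Comp c),
  path (@adj (Comp c)) X q && (last X q \in images phi X)].
have [/existsP[X /existsP[n /existsP[q /andP[pq]]]]|nfar] :=
  boolP [exists X, near X].
  case/imagesP=> u uX uY; have [p [pp lp sp]] := comp_path_changes pq uX uY.
  have [p' [pp' up' lp' sp']] := path_shortcut c pp.
  exists u, p'; split=> //; first by rewrite lp'.
  (* The shortcut only deletes colors, and removing the color in front adds no change. *)
  apply: leq_trans (changes_subseq sp') _.
  apply: leq_trans (changes_cons _ _) (leq_trans sp _).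
  by rewrite size_tuple -ltnS.
exfalso; apply: (@evasion_impossible _ (@adj (Comp c)) (@hue G c) (images phi) k
  (component_of c true v0) (component_of c true (phi v0))).
- exact: adj_sym.
- exact: comp_adj_hue.
- exact: images_connected.
- move=> X s ps ls; rewrite ltnNge; apply: contra nfar => sk.
  apply/existsP; exists X; apply/existsP.
  exists (Ordinal (sk : size s < k.+1)); apply/existsP.
  by exists (in_tuple s); rewrite ps.
- exact: images_edge.
- exact: images_meet.
- by apply/imagesP; exists v0; exact: mem_component_of.
- exact: component_of_connect.
(* [cycle] also accepts lists of at most two vertices; these are shorter than [2 * k.+2] anyway. *)
move=> s us cs; have [s2|s2] := leqP (size s) 2; first by lia.
apply: leq_trans (leq_ltn_trans (size_cycle_circumference s2 us cs) hcyc) _.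
by lia.
Qed.
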